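(* Let $D_1\subset D_2$ be dendrites, let $f:D_1\to D_2$ be a continuous map, and let $E=\overline{D_2\setminus D_1}\cap D_1$. Suppose that $f$ scrambles the boundary, i.e. for each point $e\in E$ with $f(e)\ne e$, the point $f(e)$ is contained in a component of $D_2\setminus\{e\}$ which meets $D_1$. Then $f$ has a fixed point (in $D_1$).
   Context: A dendrite is a locally connected (metric) continuum containing no simple closed curve. *)

(* Defs.v *)
From HB Require Import structures.
From mathcomp Require Import all_boot all_order all_algebra.
From mathcomp Require Import all_classical all_reals all_analysis.

Set Implicit Arguments.
Unset Strict Implicit.
Unset Printing Implicit Defensive.

Import Order.TTheory GRing.Theory Num.Theory.
Import numFieldNormedType.Exports.

Local Open Scope classical_set_scope.
Local Open Scope ring_scope.

(* The subspace topology of A has a base of connected open sets; the open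
   subsets of A are the traces V `&` A of the open sets V of T. *)
Definition locally_connected (T : topologicalType) (A : set T) : Prop :=
  forall (x : T) (U : set T), A x -> open U -> U x ->
    exists V : set T,
      [/\ open V, V x, V `&` A `<=` U & connected (V `&` A)].

(* A and B are homeomorphic for their subspace topologies; only the values of
   f on A and of g on B matter. *)
Definition homeomorphic (T U : topologicalType) (A : set T) (B : set U) : Prop :=
  exists (f : T -> U) (g : U -> T),
    [/\ set_fun A B f /\ set_fun B A g,
        {in A, cancel f g},
        {in B, cancel g f},
        {within A, continuous f} &
        {within B, continuous g}].

Definition unit_circle (R : realType) : set (R * R) :=
  [set z | z.1 ^+ 2 + z.2 ^+ 2 = 1].

Definition simple_closed_curve (R : realType) (T : metricType R) (S : set T) :
  Prop := homeomorphic (@unit_circle R) S.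

(* A one-point space is allowed, the empty set is not. *)
Definition continuum (T : topologicalType) (A : set T) : Prop :=
  [/\ A !=set0, compact A & connected A].

Definition dendrite (R : realType) (T : metricType R) (D : set T) : Prop :=
  [/\ continuum D,
      locally_connected D &
      ~ (exists2 S : set T, S `<=` D & simple_closed_curve S)].

Definition components (T : topologicalType) (A : set T) : set (set T) :=
  connected_component A @` A.

(* D2 being closed in T, the closure below, taken in T, is also the closure
   in D2. *)
Definition boundary (T : topologicalType) (D1 D2 : set T) : set T :=
  closure (D2 `\` D1) `&` D1.

Definition scrambles_boundary (T : topologicalType) (D1 D2 : set T)
    (f : T -> T) : Prop :=
  forall e : T, boundary D1 D2 e -> f e <> e ->
    exists2 K : set T, components (D2 `\ e) K & K (f e) /\ K `&` D1 !=set0.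

(* Main.v *)
Require Import Defs.
From HB Require Import structures.
From mathcomp Require Import all_boot all_order all_algebra.
From mathcomp Require Import all_classical all_reals all_analysis.
From mathcomp Require Import lra.

Set Implicit Arguments.
Unset Strict Implicit.
Unset Printing Implicit Defensive.

Import Order.TTheory GRing.Theory Num.Theory.
Import numFieldNormedType.Exports.

Local Open Scope classical_set_scope.
Local Open Scope ring_scope.

(* Write [between D2 a x b] when every connected subset of [D2] containing [a]
   and [b] contains [x], fix [p] in [D1], and order the points by
   [x <= y] iff [between D2 p x y].  The set [S] of the points [x] of [D1] with
   [x <= f x] is compact and contains [p], so it has a maximal element [x0].
   If [f x0 <> x0], then some [x] strictly between [x0] and [f x0] can be taken
   arbitrarily close to [x0]; it lies in [D1], trivially if [x0] is not in the
   boundary, and otherwise because, [f] scrambling the boundary, [x] also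
   separates [x0] from a point of [D1].  By continuity [x <= f x], which
   contradicts the maximality of [x0].

   That distinct points [a], [b] of a dendrite are separated by a third point is
   the only place where simple closed curves matter.  If the midpoint of an arc
   from [a] to [b] does not separate them, they are joined by a second arc which
   avoids it, and the two arcs contain a simple closed curve.  An arc is obtained
   by building a path as a limit of finer and finer chains of points, by cutting
   out of it a maximal family of loops, which leaves a path with convex fibers,
   and by reparametrising this path with a continuous monotone function which has
   the same fibers. *)

(** * Metric neighbourhoods, compactness and connectedness *)

Lemma nbhs_mdistP (R : realType) (T : metricType R) (x : T) (P : set T) :
  nbhs x P <-> exists2 e, 0 < e & forall y, mdist x y < e -> P y.
Proof.
rewrite -filter_from_ballE; split=> -[e e0 he]; exists e => // y.
  by move=> xy; apply: he; rewrite ballEmdist.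
by rewrite ballEmdist; exact: he.
Qed.

Lemma nbhs_within_mdistP (R : realType) (T : metricType R) (U : topologicalType)
    (A : set T) (f : T -> U) :
  {within A, continuous f} <->
  forall x, A x -> forall V, nbhs (f x) V ->
    exists2 e, 0 < e & forall y, A y -> mdist x y < e -> V (f y).
Proof.
rewrite subspace_continuousP; split=> h x Ax V.
  move=> /(h _ Ax)/nbhs_mdistP[e e0 he]; exists e => // y Ay xy.
  exact: he.
move=> /(h _ Ax)[e e0 he]; apply/nbhs_mdistP; exists e => // y xy Ay.
exact: he.
Qed.

(** If no member contained [K], the complements in [K] of the members would form a filter base. A
    cluster point of it in [K] lies in some open [X] of [F], which does not meet its own
    complement. *)
Lemma compact_open_chain (T : topologicalType) (K : set T) (F : set (set T)) :
  compact K -> F !=set0 -> (forall X, F X -> open X) -> total_on F subset ->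
  K `<=` \bigcup_(X in F) X -> exists2 X, F X & K `<=` X.
Proof.
move=> cK [X0 FX0] oF tF KF; apply: contrapT => nX.
have [] := cK (filter_from F (fun X => K `\` X)).
- apply: filter_from_proper.
    apply: filter_from_filter; first by exists X0.
    move=> X Y FX FY; have [XY|YX] := tF X Y FX FY.
      by exists Y => // z [Kz nYz]; split; split => // /XY.
    by exists X => // z [Kz nXz]; split; split => // /YX.
  move=> X FX; apply: contrapT => h; apply: nX; exists X => // z Kz.
  by apply: contrapT => nXz; apply: h; exists z.
- by exists X0 => // z [].
move=> z [Kz clz]; have [X FX Xz] := KF z Kz.
have [|w [[_ nXw] //]] := clz (K `\` X) X _ (open_nbhs_nbhs (conj (oF _ FX) Xz)).
by exists X.
Qed.

Lemma open_locally (T : topologicalType) (Q : set T) :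
  (forall y, Q y -> exists V, [/\ open V, V y & V `<=` Q]) -> open Q.
Proof.
move=> h; rewrite openE => y /h[V [oV Vy VQ]]; rewrite /interior nbhsE.
by exists V.
Qed.

(** Zorn's lemma for a preorder with closed upper sets, where compactness bounds every chain. It
    yields extremal points for [between] read in either direction. *)
Lemma compact_premaximal (T : topologicalType) (K : set T) (r : T -> T -> Prop) :
  compact K -> K !=set0 -> (forall x, K x -> r x x) ->
  (forall x y z, r x y -> r y z -> r x z) ->
  (forall x y, K x -> K y -> ~ r x y ->
     exists U, [/\ open U, U y & forall z, K z -> U z -> ~ r x z]) ->
  exists2 m, K m & forall z, K z -> r m z -> r z m.
Proof.
move=> cK [x0 Kx0] rr rt rc.
pose q (x y : {x | K x}) := `[< r (sval x) (sval y) >].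
have [| | |[m Km] hm] := @ZL_preorder _ (exist _ x0 Kx0) q.
- by move=> [x Kx]; apply/asboolP; exact: rr.
- by move=> x y z /asboolP h1 /asboolP h2; apply/asboolP; apply: rt h1 h2.
- move=> A totA.
  have [[a Aa]|nA] := pselect (A !=set0); last first.
    by exists (exist _ x0 Kx0) => s As; exfalso; apply: nA; exists s.
  apply: contrapT => nub.
  (* [O x] consists of the points near which nothing in [K] is above [x]. Without an upper bound for
     the chain these sets cover [K], so a single [O a'] does, against [r a' a']. *)
  pose O (x : T) := [set z | exists U, [/\ open U, U z &
    forall w, K w -> U w -> ~ r x w]].
  have Oo x : open (O x).
    apply: open_locally => z [U [oU Uz hU]]; exists U; split => // w Uw.
    by exists U.
  have rO x y z : r x y -> O x z -> O y z.
    move=> xy [U [oU Uz hU]]; exists U; split => // w Kw Uw yw.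
    by apply: (hU w) => //; apply: rt xy yw.
  have [||||_ [a' _ <-] hX] :=
      @compact_open_chain T K ((O \o sval) @` A) cK.
  + by exists (O (sval a)); exists a.
  + by move=> _ [a' _ <-]; exact: Oo.
  + move=> _ _ [a1 A1 <-] [a2 A2 <-].
    by have [/asboolP h|/asboolP h] := totA _ _ A1 A2; [left|right] => z;
      apply: rO h.
  + move=> z Kz; apply: contrapT => nz; apply: nub; exists (exist _ z Kz).
    move=> [s Ks] As; apply/asboolP => /=; apply: contrapT => nsz; apply: nz.
    by exists (O s); [exists (exist _ s Ks)|exact: rc].
  + case: a' hX => a' Ka' /= hX.
    by have [U [oU Ua hU]] := hX _ Ka'; apply: (hU a') => //; exact: rr.
- exists m => // z Kz mz.
  by have /asboolP := hm (exist _ z Kz) (asboolT mz).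
Qed.

(** The predicate [B] is locally constant on [C], so it cuts out a nonempty relatively clopen
    subset. *)
Lemma connected_ind (T : topologicalType) (C : set T) (B : T -> Prop) :
  connected C -> (exists2 x, C x & B x) ->
  (forall y, C y -> exists V, [/\ open V, V y &
     forall z z', C z -> C z' -> V z -> V z' -> B z -> B z']) ->
  forall x, C x -> B x.
Proof.
move=> cC [x0 Cx0 Bx0] h.
pose O (P : T -> Prop) := [set y | exists V, [/\ open V, V y &
  forall z, C z -> V z -> P z]].
have Oo P : open (O P).
  apply: open_locally => z [U [oU Uz hU]]; exists U; split => // w Uw.
  by exists U.
have OB y : C y -> B y -> O B y.
  move=> Cy By; have [V [oV Vy hV]] := h y Cy.
  by exists V; split => // z Cz Vz; apply: (hV y z).
have OnB y : C y -> ~ B y -> O (fun z => ~ B z) y.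
  move=> Cy By; have [V [oV Vy hV]] := h y Cy.
  by exists V; split => // z Cz Vz Bz; apply: By; apply: (hV z y).
have E : C `&` B = C; last by move=> x; rewrite -{1}E => -[].
apply: cC; first by exists x0.
- exists (O B) => //; apply/seteqP; split=> y [Cy].
    by move=> By; split => //; exact: OB.
  by move=> [V [_ Vy hV]]; split => //; apply: hV.
- exists (~` O (fun z => ~ B z)); first exact: open_closedC.
  apply/seteqP; split=> y [Cy].
    by move=> By; split => // -[V [_ Vy hV]]; apply: (hV y).
  by move=> nO; split => //; apply: contrapT => /(OnB _ Cy).
Qed.

(** * Separation in locally connected spaces *)

Section Between.
Context {R : realType} {T : metricType R}.
Variable D : set T.

Definition between (a x b : T) : Prop :=
  forall A, A `<=` D -> connected A -> A a -> A b -> A x.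

Hypothesis cD : connected D.
Hypothesis lD : locally_connected D.

Lemma between_right a b : between a b b.
Proof. by move=> A. Qed.

Lemma between_trans p x y z : between p x y -> between p y z -> between p x z.
Proof. by move=> h1 h2 A AD cA Ap Az; apply: h1 => //; exact: h2. Qed.

Lemma between_mem a x b : D a -> D b -> between a x b -> D x.
Proof. by move=> Da Db; exact. Qed.

Lemma nbetweenP a x b : ~ between a x b ->
  exists A, [/\ A `<=` D, connected A, A a, A b & ~ A x].
Proof.
move=> /existsNP[A h]; exists A.
by move: h => /not_implyP[? /not_implyP[? /not_implyP[? /not_implyP[? ?]]]].
Qed.

Lemma small_connected x e : D x -> 0 < e ->
  exists V, [/\ open V, V x, connected (V `&` D) &
    forall z, V z -> D z -> mdist x z < e].
Proof.
move=> Dx e0.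
have [//||V [oV Vx VU cV]] := @lD x (ball x e)° Dx.
- exact: open_interior.
- exact: (open_nbhs_ball x (PosNum e0)).2.
- exists V; split => // z Vz Dz.
  have /interior_subset : (ball x e)° z by apply: VU.
  by rewrite ballEmdist.
Qed.

Lemma connected_far A x : A `<=` D -> connected A -> ~ A x ->
  forall a b, A a -> A b -> exists B e, [/\ B `<=` D, connected B, B a, B b &
    0 < e /\ forall z, mdist x z < e -> ~ B z].
Proof.
move=> AD cA nAx a b Aa Ab.
have far y : A y -> exists e V, [/\ 0 < e, open V, V y, connected (V `&` D) &
    forall z, mdist x z < e -> ~ V z \/ ~ D z].
  (* With half of the distance, the balls of radius [e] around [x] and [y] are disjoint. *)
  move=> Ay; pose e := mdist x y / 2.
  have e0 : 0 < e.
    by rewrite divr_gt0// mdist_gt0; apply/eqP => xy; apply: nAx; rewrite xy.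
  have [V [oV Vy cV hV]] := small_connected (AD _ Ay) e0.
  exists e, V; split => // z xz; apply/not_andP => -[Vz Dz].
  have := metric_triangle x z y; rewrite (metric_sym z y).
  have := hV z Vz Dz; rewrite /e in xz *; lra.
apply: (@connected_ind _ A (fun b => exists B e, [/\ B `<=` D, connected B, B a,
  B b & 0 < e /\ forall z, mdist x z < e -> ~ B z])) => //.
- exists a => //; have [e [V [e0 oV Va cV hV]]] := far a Aa.
  have VDa : (V `&` D) a by split => //; exact: AD.
  exists (V `&` D), e; split => //.
  by split => // z /hV[h|h] [Vz Dz].
- move=> y Ay; have [e [V [e0 oV Vy cV hV]]] := far y Ay.
  exists V; split => // z z' Az Az' Vz Vz' [B [e' [BD cB Ba Bz [e'0 hB]]]].
  exists (B `|` (V `&` D)), (Num.min e e'); split.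
  + by move=> w [/BD//|[]].
  + by apply: connectedU => //; exists z; split => //; split => //; exact: AD.
  + by left.
  + by right; split => //; exact: AD.
  split; first by rewrite lt_min e0.
  by move=> w; rewrite lt_min => /andP[/hV h /hB nB] [//|[? ?]]; case: h.
Qed.

Lemma nbetween_far a x b : ~ between a x b -> exists B e,
  [/\ B `<=` D, connected B, B a, B b & 0 < e /\ forall z, mdist x z < e -> ~ B z].
Proof. by move=> /nbetweenP[A [AD cA Aa Ab nAx]]; exact: (connected_far AD). Qed.

(** This makes [between p] a closed relation on [D]. A connected set that stays away from [x] is
    joined to every [y'] near [y] by a small connected neighbourhood of [y]. *)
Lemma nbetween_open p x y : D y -> ~ between p x y ->
  exists e, 0 < e /\ forall x' y', mdist x x' < e -> D y' -> mdist y y' < e ->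
    ~ between p x' y'.
Proof.
move=> Dy /nbetween_far[B [e [BD cB Bp By [e0 hB]]]].
(* The first bound keeps [x'] off [B], the second keeps it off the neighbourhood [V] of [y]. *)
pose r := Num.min (e / 2) (mdist x y / 2).
have xy : 0 < mdist x y.
  by rewrite mdist_gt0; apply/eqP => xy; apply: (hB x); rewrite ?mdistxx// xy.
have r0 : 0 < r by rewrite lt_min !divr_gt0.
have [V [oV Vy cV hV]] := small_connected Dy r0.
have /nbhs_mdistP[e' e'0 he'] : nbhs y V by exact: open_nbhs_nbhs.
exists (Num.min r e'); split; first by rewrite lt_min r0.
move=> x' y'; rewrite !lt_min => /andP[/andP[h1 h2] _] Dy' /andP[_ yy'].
move=> /(_ (B `|` (V `&` D))) h.
suff : (B `|` (V `&` D)) x'.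
  move=> [|[Vx' Dx']]; first by apply: hB; lra.
  have := hV _ Vx' Dx'; rewrite lt_min => /andP[_ h3].
  have := metric_triangle x x' y; rewrite (metric_sym x' y); lra.
apply: h; [by move=> z [/BD|[]]| |by left|by right; split => //; exact: he'].
by apply: connectedU => //; exists y.
Qed.

(** The component [C] has [x] in its closure. Otherwise membership in [C] is locally constant on
    [D]: near [x] there is nothing of [C], and elsewhere a small connected neighbourhood avoids [x].
    Then [C] would contain [x]. *)
Lemma component_adjoin p x : D p -> D x -> p <> x ->
  connected (connected_component (D `\ x) p `|` [set x]).
Proof.
move=> Dp Dx px; set C := connected_component _ _.
have Cp : C p by exact: connected_component_refl.
have cC : connected C by exact: component_connected.
(* Granted this, a clopen part that meets [C] contains [C] and hence its limit [x], and a clopen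
   part that contains [x] meets [C]. *)
suff clx : closure C x.
  move=> B [z Bz] [U oU BU] [K cK BK].
  apply/seteqP; split; first by rewrite BU => w [].
  have [[w [Bw Cw]]|nBC] := pselect (exists w, B w /\ C w).
    have CB : C `&` B = C.
      apply: cC; first by exists w.
        exists U => //; apply/seteqP; split=> v [Cv]; rewrite BU.
          by case.
        by move=> Uv; split => //; split => //; left.
      exists K => //; apply/seteqP; split=> v [Cv]; rewrite BK.
        by case.
      by move=> Uv; split => //; split => //; left.
    move=> v [Cv|->]; first by rewrite -CB in Cv; case: Cv.
    rewrite BK; split; first by right.
    suff : closure C `<=` K by apply.
    rewrite [K](closure_id _).1//; apply: closure_subset => u.
    by rewrite -CB BK => -[_ []].
  have zx : z = x.
    have : (C `|` [set x]) z by move: Bz; rewrite BU => -[].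
    by move=> [Cz|//]; exfalso; apply: nBC; exists z.
  have Ux : U x by move: Bz; rewrite zx BU => -[].
  have [w [Cw Uw]] := clx U (open_nbhs_nbhs (conj oU Ux)).
  by exfalso; apply: nBC; exists w; split => //; rewrite BU; split => //; left.
apply: contrapT => nclx.
have [V nV CV] : exists2 V, nbhs x V & C `&` V = set0.
  move: nclx => /existsNP[V /not_implyP[nV hV]]; exists V => //.
  by apply/eqP/negPn/negP => /set0P.
suff : C x by move=> /connected_component_sub[_]; apply.
apply: (@connected_ind _ D C) => //; first by exists p.
move=> y Dy; have [->|yx] := pselect (y = x).
  exists V°; split; [exact: open_interior|exact: nV|].
  move=> z z' _ _ /interior_subset Vz _ Cz.
  by have : (C `&` V) z by []; rewrite CV.
have yx0 : 0 < mdist y x by rewrite mdist_gt0; apply/eqP.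
have [W [oW Wy cW hW]] := small_connected Dy yx0.
exists W; split => // z z' Dz Dz' Wz Wz'.
rewrite /C => Cz; apply: (connected_component_trans Cz).
exists (W `&` D) => //; split => // w [Ww Dw]; split => // wx.
by have := hW _ Ww Dw; rewrite wx ltxx.
Qed.

Lemma connected_component_nself p x : ~ connected_component (D `\ x) p x.
Proof. by move=> /connected_component_sub[_]; exact. Qed.

(** The component of [p] in [D] minus [x], with [x] added, joins [p] to [x], so it contains [y]. If
    [y] is not [x], the component itself joins [p] to [y] and misses [x]. *)
Lemma between_anti p x y : D p -> D x -> D y ->
  between p x y -> between p y x -> x = y.
Proof.
move=> Dp Dx Dy xy yx; apply: contrapT => nxy.
have [px|px] := pselect (p = x).
  apply: nxy; apply/esym; rewrite -px; apply: (yx [set p]) => //.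
  - by move=> z ->.
  - exact: connected1.
have Cp : connected_component (D `\ x) p p.
  by apply: connected_component_refl; split.
have [Cy|/esym//] : (connected_component (D `\ x) p `|` [set x]) y.
  apply: yx; [|exact: component_adjoin|by left|by right].
  by move=> z [/connected_component_sub[]|->].
apply: (@connected_component_nself p x); apply: xy => //.
- by move=> z /connected_component_sub[].
- exact: component_connected.
Qed.

Hypothesis compactD : compact D.
Hypothesis sepD : forall a b, D a -> D b -> a <> b ->
  exists x, [/\ x <> a, x <> b & between a x b].

(** The points between [a] and [b] at distance at least [r] from [a] form a compact set [L]. Let [w]
    be minimal in [L] for the order from [a]: a point strictly between [a] and [w] is outside [L],
    hence close to [a]. *)
Lemma between_near a b e : D a -> D b -> a <> b -> 0 < e ->
  exists x, [/\ x <> a, between a x b & mdist a x < e].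
Proof.
move=> Da Db ab e0.
(* The bound [mdist a b] puts [b] in [L]. *)
pose r := Num.min e (mdist a b).
have r0 : 0 < r by rewrite lt_min e0 mdist_gt0; exact/eqP.
pose L := D `&` [set x | between a x b /\ r <= mdist a x].
have Lb : L b.
  by split => //; split; [exact: between_right|rewrite ge_min lexx orbT].
have cL : compact L.
  apply: (subclosed_compact _ compactD) => [z clz|z []//].
  have Dz : D z.
    apply: (compact_closed (@metric_hausdorff _ T) compactD).
    by apply: closure_subset clz => y [].
  split => //; split.
    apply: contrapT => /(nbetween_open Db)[s [s0 hs]].
    have [y [[Dy [ayb _]]]] := clz _ (nbhsx_ballx z _ s0).
    by rewrite ballEmdist => zy; apply: (hs y b) => //; rewrite mdistxx.
  rewrite leNgt; apply/negP => zr.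
  have s0 : 0 < r - mdist a z by rewrite subr_gt0.
  have [y [[Dy [_ ry]]]] := clz _ (nbhsx_ballx z _ s0).
  by rewrite ballEmdist /= => zy; have := metric_triangle a z y; lra.
have [w [Dw [awb rw]] hw] : exists2 w, L w & forall z, L z ->
    between a z w -> between a w z.
  apply: (compact_premaximal (r := fun x y => between a y x)) => //.
  - by exists b.
  - by move=> x Lx; exact: between_right.
  - by move=> x y z yx zy; exact: between_trans zy yx.
  - move=> x y [Dx _] [Dy _] /(nbetween_open Dx)[s [s0 hs]].
    exists (ball y s)°; split.
    + exact: open_interior.
    + exact: (open_nbhs_ball y (PosNum s0)).2.
    + move=> z _ /interior_subset; rewrite ballEmdist => yz.
      by apply: hs => //; rewrite mdistxx.
have aw : a <> w.
  by move=> aw; move: rw; rewrite -aw mdistxx leNgt r0.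
have [v [va vw avw]] := sepD Da Dw aw.
have Dv : D v by exact: between_mem avw.
have avb : between a v b by exact: between_trans avw awb.
exists v; split => //.
suff : mdist a v < r by rewrite lt_min => /andP[].
rewrite ltNge; apply/negP => rv; apply: vw.
by apply: (between_anti Da) => //; apply: hw.
Qed.

End Between.

(** * Fixed points when third points separate *)

Lemma fixed_point_of_separators (R : realType) (T : metricType R)
    (D1 D2 : set T) (f : T -> T) :
  continuum D1 -> continuum D2 -> locally_connected D2 ->
  (forall a b, D2 a -> D2 b -> a <> b ->
    exists x, [/\ x <> a, x <> b & between D2 a x b]) ->
  D1 `<=` D2 -> {within D1, continuous f} -> set_fun D1 D2 f ->
  scrambles_boundary D1 D2 f -> exists2 x : T, D1 x & f x = x.
Proof.
move=> [[p D1p] kD1 cD1] [_ kD2 cD2] lD2 sepD2 D12 /nbhs_within_mdistP cf fD hscr.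
pose S := D1 `&` [set x | between D2 p x (f x)].
have Sp : S p by split => // A.
have D2p := D12 _ D1p.
have cS : compact S.
  apply: (subclosed_compact _ kD1) => [z clz|z []//].
  have Dz : D1 z.
    apply: (compact_closed (@metric_hausdorff _ T) kD1).
    by apply: closure_subset clz => y [].
  split => //.
  (* A failure of [between D2 p z (f z)] persists near [z] by continuity of [f], so [S] is
     closed. *)
  apply: contrapT => /(nbetween_open lD2 (fD _ Dz))[s [s0 hs]].
  have [s' s'0 hs'] := cf z Dz _ (nbhsx_ballx (f z) _ s0).
  have m0 : 0 < Num.min s s' by rewrite lt_min s0.
  have [y [[Dy pyf]]] := clz _ (nbhsx_ballx z _ m0).
  rewrite ballEmdist /= lt_min => /andP[zy zy'].
  apply: (hs y (f y)) => //; first exact: fD.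
  by have := hs' y Dy zy'; rewrite ballEmdist.
have [x0 [Dx0 pxf] maxx0] : exists2 x0, S x0 & forall z, S z ->
    between D2 p x0 z -> between D2 p z x0.
  apply: (compact_premaximal (r := between D2 p)) => //.
  - by exists p.
  - by move=> x Sx; exact: between_right.
  - by move=> x y z; exact: between_trans.
  - move=> x y [Dx _] [Dy _] /(nbetween_open lD2 (D12 _ Dy))[s [s0 hs]].
    exists (ball y s)°; split.
    + exact: open_interior.
    + exact: (open_nbhs_ball y (PosNum s0)).2.
    + move=> z [Dz _] /interior_subset; rewrite ballEmdist => yz.
      by apply: hs => //; [rewrite mdistxx|exact: D12].
exists x0 => //; apply: contrapT => fx0.
have D2x0 := D12 _ Dx0; have Df0 := fD _ Dx0.
have [e1 e10 he1] : exists2 e1, 0 < e1 & forall x, mdist x0 x < e1 ->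
    between D2 x0 x (f x0) -> D1 x.
  have [bx0|] := pselect (boundary D1 D2 x0).
    have [_ [k _ <-] []] := hscr x0 bx0 fx0.
    move=> Kf [d [Kd D1d]].
    set K := connected_component _ _ in Kf Kd.
    have KD : K `<=` D2 by move=> z /connected_component_sub[].
    have cK : connected K by exact: component_connected.
    have nKx0 : ~ K x0 by exact: connected_component_nself.
    (* The set [B] joins [f x0] to the point [d] of [D1] and stays away from [x0]. As [D1] and [B]
       together join [x0] to [f x0], a point between these two lies in one of them, and near [x0] it
       must lie in [D1]. *)
    have [B [e [BD cB Bf Bd [e0 hB]]]] := connected_far lD2 KD cK nKx0 Kf Kd.
    exists e => // x xe xb.
    have [//|Bx] : (D1 `|` B) x; last by case: (hB x).
    apply: xb; [by move=> z [/D12|/BD]| |by left|by right].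
    by apply: connectedU => //; exists d.
  move=> nb; have : ~ closure (D2 `\` D1) x0 by move=> h; apply: nb.
  move=> /existsNP[V /not_implyP[/nbhs_mdistP[e e0 eV] nV]].
  exists e => // x /eV Vx xb; apply: contrapT => nD1x; apply: nV; exists x.
  by split => //; split => //; exact: between_mem xb.
(* Points within [r] of [x0] are not within [r] of [f x0], so [x] will be off [V]. *)
pose r := mdist (f x0) x0 / 2.
have r0 : 0 < r by rewrite divr_gt0// mdist_gt0; exact/eqP.
have [V [oV Vf cV hV]] := small_connected lD2 Df0 r0.
have [e2 e20 he2] := cf x0 Dx0 V (open_nbhs_nbhs (conj oV Vf)).
have e0 : 0 < Num.min r (Num.min e1 e2) by rewrite !lt_min r0 e10.
have x0f : x0 <> f x0 by move=> h; apply: fx0.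
have [x [xx0 x0x]] := between_near cD2 lD2 kD2 sepD2 D2x0 Df0 x0f e0.
rewrite !lt_min => /and3P[xr x1 x2].
have D1x : D1 x by exact: he1.
have D2x := D12 _ D1x.
have VDx : ~ V x.
  move=> Vx; have := hV x Vx D2x.
  have := metric_triangle (f x0) x x0; rewrite (metric_sym x x0) /r in xr *; lra.
have Vfx : V (f x) by exact: he2.
have VVx : (V `&` D2) (f x) by split => //; exact: fD.
have VVx0 : (V `&` D2) (f x0) by [].
(* Suppose [A] joins [p] to [x] and misses [x0]. The component [C] of [f x0] in [D2] minus [x0]
   contains [x], because [C] with [x0] added joins [x0] to [f x0]. Then [A] and [C] join [p] to
   [f x0] without [x0], against [pxf]. *)
have px0x : between D2 p x0 x.
  move=> A AD cA Ap Ax; apply: contrapT => nAx0.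
  pose C := connected_component (D2 `\ x0) (f x0).
  have Cx : C x.
    have [//|//] : (C `|` [set x0]) x.
    apply: x0x; [|exact: component_adjoin|by right|left].
      by move=> z [/connected_component_sub[]|->].
    by apply: connected_component_refl; split.
  have [Ax0|] : (A `|` C) x0; [|by []|exact: connected_component_nself].
  apply: pxf.
  - by move=> z [/AD|/connected_component_sub[]].
  - apply: connectedU => //; first by exists x.
    exact: component_connected.
  - by left.
  - by right; apply: connected_component_refl; split.
(* It remains to show [between D2 p x (f x)], which puts [x] in [S] above the maximal [x0];
   antisymmetry then gives [x = x0]. *)
apply: xx0; apply/esym/(between_anti cD2 lD2 D2p D2x0 D2x px0x).
apply: maxx0 => //.
(* If [A] joins [p] to [f x] without [x], adding [V] extends it to [f x0]. The union contains [x0]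
   by [pxf], hence [x] by [x0x], yet neither [A] nor [V] contains [x]. *)
split => // A AD cA Ap Afx; apply: contrapT => nAx.
have cAV : connected (A `|` (V `&` D2)).
  by apply: connectedU => //; exists (f x).
have AVD : A `|` (V `&` D2) `<=` D2 by move=> z [/AD|[]].
have AVf : (A `|` (V `&` D2)) (f x0) by right.
have AVx0 : (A `|` (V `&` D2)) x0 by apply: pxf => //; left.
by have [//|[]] := x0x _ AVD cAV AVx0 AVf.
Qed.

(** * Paths and arcs *)

Section Paths.
Context {R : realType} {T : metricType R}.
Variable D : set T.
Hypothesis lD : locally_connected D.
Hypothesis kD : compact D.

(** Compactness makes the radius uniform. The set found at a centre has radius [e / 2], since it
    must stay within [e] of every nearby point. *)
Lemma uniformly_locally_connected e : 0 < e -> exists2 s, 0 < s &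
  forall x y, D x -> D y -> mdist x y < s ->
    exists V, [/\ V `<=` D, connected V, V x, V y & forall z, V z -> mdist x z < e].
Proof.
move=> e0.
pose P (s : R) x := D x -> forall y, D y -> mdist x y < s ->
    exists V, [/\ V `<=` D, connected V, V x, V y & forall z, V z -> mdist x z < e].
have : \forall s \near 0^'+, D `<=` P s.
  move: kD => /compact_near_coveringP; apply => x Dx.
  have e20 : 0 < e / 2 by rewrite divr_gt0.
  have [V [oV Vx cV hV]] := small_connected lD Dx e20.
  have /nbhs_mdistP[e' e'0 he'] : nbhs x V by exact: open_nbhs_nbhs.
  exists (ball x (e' / 2), [set s | s < e' / 2]) => /=.
    split; first by apply: nbhsx_ballx; rewrite divr_gt0.
    by apply: nbhs_right_lt; rewrite divr_gt0.
  move=> [x' s] [] /=; rewrite ballEmdist /= => xx' se Dx' y Dy x'y.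
  have xz := metric_triangle x x' y.
  exists (V `&` D); split => //.
  - by split => //; apply: he'; lra.
  - by split => //; apply: he'; lra.
  - move=> z [Vz Dz]; have := hV z Vz Dz.
    have : mdist x x' < e / 2.
      by apply: hV => //; apply: he'; lra.
    have := metric_triangle x' x z; rewrite (metric_sym x' x); lra.
move=> /(filterI (nbhs_right_gt (0:R)))/filter_ex[s [s0 hs]].
by exists s => // x y Dx; exact: hs.
Qed.

(** A finite chain is encoded as a sequence constant from index [n] on, so it can be padded to any
    greater length. *)
Lemma connected_chain (V : set T) x y s : connected V -> V x -> V y -> 0 < s ->
  exists n (c : nat -> T), [/\ c 0%N = x, forall i, (n <= i)%N -> c i = y,
    forall i, V (c i) & forall i, mdist (c i) (c i.+1) < s].
Proof.
move=> cV Vx Vy s0; move: y Vy.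
apply: (connected_ind cV).
  by exists x => //; exists 0%N, (fun=> x); split => // i; rewrite mdistxx.
move=> y Vy; exists (ball y (s / 2))°; split.
- exact: open_interior.
- have s20 : 0 < s / 2 by rewrite divr_gt0.
  exact: (open_nbhs_ball y (PosNum s20)).2.
move=> z z' Vz Vz' /interior_subset + /interior_subset.
rewrite !ballEmdist /= => yz yz' [n [c [c0 cn cV' cs]]].
exists n.+1, (fun i => if (i <= n)%N then c i else z'); split => //.
- by move=> i ni; rewrite leqNgt ni.
- by move=> i; case: ifP.
- move=> i; case: ltnP => [ni|ni]; first by rewrite ltnW.
  case: leqP => [ni'|_]; last by rewrite mdistxx.
  rewrite cn//; have := metric_triangle z y z'; rewrite (metric_sym z y); lra.
Qed.

(** Every link becomes a chain of the same number [N] of steps, so index [i * N + j] is place [j]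
    inside link [i]. This lets successive chains be compared at equal times. *)
Lemma refine_chain (e s s' : R) (P : nat) (c : nat -> T) (b : T) : 0 < s' ->
  (forall x y, D x -> D y -> mdist x y < s ->
    exists V, [/\ V `<=` D, connected V, V x, V y & forall z, V z -> mdist x z < e]) ->
  (forall i, (P <= i)%N -> c i = b) -> (forall i, D (c i)) ->
  (forall i, mdist (c i) (c i.+1) < s) ->
  exists (N : nat) (c' : nat -> T), [/\ (0 < N)%N,
    forall i, (P * N <= i)%N -> c' i = b, forall i, D (c' i),
    forall i, mdist (c' i) (c' i.+1) < s' &
    forall i j, (j < N)%N -> (j = 0%N -> c' (i * N + j)%N = c i) /\
       mdist (c i) (c' (i * N + j)%N) < e].
Proof.
move=> s'0 us cP cD cs.
have /choice[q hq] : forall i, exists q : nat * (nat -> T),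
    [/\ q.2 0%N = c i, forall j, (q.1 <= j)%N -> q.2 j = c i.+1,
    forall j, D (q.2 j) /\ mdist (c i) (q.2 j) < e &
    forall j, mdist (q.2 j) (q.2 j.+1) < s'].
  move=> i; have [V [VD cV Vc Vc' Ve]] := us _ _ (cD i) (cD i.+1) (cs i).
  have [n [k [k0 kn kV ks]]] := connected_chain cV Vc Vc' s'0.
  by exists (n, k); split => // j; split; [apply: VD|apply: Ve].
(* The longest piece fixes the common length; the successor makes it positive. *)
pose N := (\max_(i < P) (q i).1).+1.
pose c' m := if (m %/ N < P)%N then (q (m %/ N)%N).2 (m %% N)%N else b.
have c'E i j : (j < N)%N -> c' (i * N + j)%N = if (i < P)%N then (q i).2 j else b.
  by move=> jN; rewrite /c' divnMDl// divn_small// addn0 modnMDl modn_small.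
have e0 : 0 < e.
  by have [_ _ /(_ 0%N)[_ +] _] := hq 0%N; apply: le_lt_trans; exact: mdist_ge0.
have c'0 i : c' (i * N)%N = c i.
  rewrite -[(i * N)%N]addn0 c'E//; case: ltnP => iP; last by rewrite cP.
  by have [] := hq i.
exists N, c'; split => //.
- by move=> i; rewrite -leq_divRL// /c' => h; rewrite ltnNge h.
- move=> i; rewrite /c'; case: ifP => _; last by rewrite -(cP P).
  by have [_ _ /(_ (i %% N)%N)[]] := hq (i %/ N)%N.
- move=> m; have mN : (m %% N < N)%N by rewrite ltn_mod.
  rewrite (divn_eq m N); move: (m %/ N)%N (m %% N)%N mN => i j jN.
  have [jN'|jN'] := ltnP j.+1 N.
    rewrite -addnS !c'E//; case: ifP => _; last by rewrite mdistxx.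
    by have [_ _ _] := hq i.
  have jE : j.+1 = N by apply/eqP; rewrite eqn_leq jN' jN.
  rewrite -addnS jE -mulSnr c'0 c'E//; case: ltnP => iP; last first.
    by rewrite cP ?mdistxx// leqW.
  have [_ h _ /(_ j)] := hq i; rewrite (h j.+1)// jE /N leqW//.
  exact: (@leq_bigmax _ (fun i : 'I_P => (q i).1) (Ordinal iP)).
- move=> i j jN; split; first by move=> ->; rewrite addn0.
  rewrite c'E//; case: ltnP => iP; last by rewrite cP ?mdistxx// .
  by have [_ _ /(_ j)[]] := hq i.
Qed.

(** The limit at [x] is a cluster point in the compact [D]. The errors telescope to a bound
    independent of [x], so convergence is uniform. *)
Lemma geometric_limit (X : Type) (g : nat -> X -> T) (r : R) :
  (forall n x, D (g n x)) ->
  (forall n x, mdist (g n x) (g n.+1 x) <= r / 2 ^+ n.+1) ->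
  exists G : X -> T, forall x, D (G x) /\
    forall n, mdist (g n x) (G x) <= r / 2 ^+ n.
Proof.
move=> gD gs.
suff /choice[G hG] : forall x, exists y, D y /\
    forall n, mdist (g n x) y <= r / 2 ^+ n by exists G.
move=> x.
have r0 : 0 <= r.
  have := le_trans (mdist_ge0 _ _) (gs 0%N x).
  by rewrite expr1 pmulr_lge0.
have tail n k : mdist (g n x) (g (n + k)%N x) <= r / 2 ^+ n - r / 2 ^+ (n + k).
  elim: k => [|k IH]; first by rewrite addn0 mdistxx subrr.
  rewrite addnS (le_trans (metric_triangle _ (g (n + k)%N x) _))//.
  have := gs (n + k)%N x; move: IH.
  have -> : r / 2 ^+ (n + k) = r / 2 ^+ (n + k).+1 + r / 2 ^+ (n + k).+1.
    rewrite exprS invfM mulrA -mulrDl; congr (_ * _); lra.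
  lra.
have gF : (g ^~ x @ \oo) D by exists 0%N => // n _; exact: gD.
have [y [Dy cy]] := kD _ gF; exists y; split => // n.
apply/ler_addgt0Pr => e e0.
have [|z [hz]] := cy [set g m x | m in [set m | (n <= m)%N]] (ball y e) _
    (nbhsx_ballx y _ e0).
  by exists n => // m /= nm; exists m.
rewrite ballEmdist /= => yz; move: hz => -[m /= nm mz].
have := tail n (m - n)%N; rewrite subnKC// mz => h.
have := metric_triangle (g n x) z y; rewrite (metric_sym z y).
have : 0 <= r / 2 ^+ m by rewrite divr_ge0// exprn_ge0.
lra.
Qed.

Lemma continuous_mdistP (f : R -> T) : continuous f <->
  forall t e, 0 < e -> exists2 s, 0 < s & forall u, `|t - u| < s ->
    mdist (f t) (f u) < e.
Proof.
split=> [cf t e e0|h t V /nbhs_mdistP[e e0 he]].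
  have /nbhs_ballP[s s0 hs] := cf t _ (nbhsx_ballx (f t) _ e0).
  by exists s => // u tu; have := hs u tu; rewrite /= ballEmdist.
have [s s0 hs] := h t e e0.
by apply/nbhs_ballP; exists s => // u tu; apply/he/hs.
Qed.

(** Iteration of [refine_chain], starting from a chain in [A]. The mesh at stage [n] is below
    [ds n], which is at most [es n] and also a modulus of uniform local connectedness at scale
    [es n]. *)
Lemma chain_tower (es : nat -> R) (A : set T) a b :
  (forall n, 0 < es n) -> A `<=` D -> connected A -> A a -> A b ->
  exists (P : nat -> nat) (c : nat -> nat -> T),
  [/\ forall n, (0 < P n)%N, forall i, A (c 0%N i),
    forall n, [/\ c n 0%N = a, forall i, (P n <= i)%N -> c n i = b,
      forall i, D (c n i) & forall i, mdist (c n i) (c n i.+1) < es n] &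
    forall n, exists N, [/\ (0 < N)%N, P n.+1 = (P n * N)%N & forall i j, (j < N)%N ->
       mdist (c n i) (c n.+1 (i * N + j)%N) < es n]].
Proof.
move=> es0 AD cA Aa Ab.
have /choice[ds hds] : forall n, exists s, [/\ 0 < s, s <= es n &
  forall x y, D x -> D y -> mdist x y < s ->
    exists V, [/\ V `<=` D, connected V, V x, V y &
      forall z, V z -> mdist x z < es n]].
  move=> n; have [s s'0 hs] := uniformly_locally_connected (es0 n).
  exists (Num.min s (es n)); split; first by rewrite lt_min s'0 es0.
    by rewrite ge_min lexx orbT.
  by move=> x y Dx Dy; rewrite lt_min => /andP[? _]; exact: hs.
pose inv n (q : nat * (nat -> T)) := [/\ (0 < q.1)%N, q.2 0%N = a,
  forall i, (q.1 <= i)%N -> q.2 i = b, forall i, D (q.2 i) &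
  forall i, mdist (q.2 i) (q.2 i.+1) < ds n].
pose rel n (q q' : nat * (nat -> T)) := exists N, [/\ (0 < N)%N,
  q'.1 = (q.1 * N)%N & forall i j, (j < N)%N ->
       mdist (q.2 i) (q'.2 (i * N + j)%N) < es n].
have step n (q : {q | inv n q}) :
    {q' : {q' | inv n.+1 q'} | rel n (sval q) (sval q')}.
  apply: cid; case: q => -[P c] [/= P0 ca cP cD cs].
  have [_ _ us] := hds n; have [ds0 _ _] := hds n.+1.
  have [N [c' [N0 c'P c'D c's hc']]] := refine_chain ds0 us cP cD cs.
  have i' : inv n.+1 ((P * N)%N, c').
    split => //=; first by rewrite muln_gt0 P0.
    by have [/(_ erefl)] := hc' 0%N 0%N N0; rewrite mul0n addn0 ca.
  exists (exist _ _ i'); exists N; split => //= i j jN.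
  by have [_] := hc' i j jN.
have [d00 _ _] := hds 0%N.
have [n [c [c0 cn cV cs]]] := connected_chain cA Aa Ab d00.
have i0 : inv 0%N (n.+1, c).
  by split => //= i; [move=> ni; apply: cn; exact: ltnW|exact: AD].
pose F := nat_rect (fun n => {q | inv n q}) (exist _ _ i0)
  (fun n q => sval (step n q)).
have Finv m : inv m (sval (F m)) by exact: svalP.
exists (fun m => (sval (F m)).1), (fun m => (sval (F m)).2); split => //.
- by move=> m; have [] := Finv m.
- move=> m; have [_ ? ? ? h] := Finv m; split => // i.
  by have [_ le _] := hds m; exact: lt_le_trans (h i) le.
- by move=> m; have := svalP (step m (F m)).
Qed.

Lemma half_pow_lt (r e : R) : 0 < e -> exists n, r / 2 ^+ n < e.
Proof.
move=> e0; pose n := (Num.truncn (r / e)).+1; exists n.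
rewrite ltr_pdivrMr ?exprn_gt0// mulrC -ltr_pdivrMr//.
rewrite (lt_trans (truncnS_gt _))// -natrX ltr_nat.
exact: ltn_expl.
Qed.

Lemma truncn_near (x y : R) : 0 <= x -> 0 <= y -> `|x - y| < 1 ->
  (Num.truncn x <= (Num.truncn y).+1)%N.
Proof.
move=> x0 y0 /ltr_distlDr xy; rewrite -ltnS truncn_lt_nat//.
by rewrite (lt_trans xy)// -addn1 natrD ltrD2r truncnS_gt.
Qed.

Lemma dist_max0 (t u : R) : `|Num.max t 0 - Num.max u 0| <= `|t - u|.
Proof.
have h1 := ler_norm (t - u); have h2 := ler_norm (u - t).
rewrite (distrC u t) in h2.
rewrite ler_norml /Num.max; apply/andP.
by case: (ltP t 0) => ?; case: (ltP u 0) => ?; split; lra.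
Qed.

(** Stage [n] reads its chain at index [t * P n] rounded down, with negative times moved to [0].
    Successive stages differ by at most [es n], and these bounds add up to [r], so the limit stays
    within [r] of the first chain. *)
Lemma path_near (A : set T) a b r : A `<=` D -> connected A -> A a -> A b ->
  0 < r -> exists g : R -> T, [/\ continuous g,
    forall t, t <= 0 -> g t = a, forall t, 1 <= t -> g t = b &
    forall t, D (g t) /\ exists2 y, A y & mdist y (g t) <= r].
Proof.
move=> AD cA Aa Ab r0.
pose es n := r / 2 ^+ n.+1.
have es0 n : 0 < es n by rewrite divr_gt0// exprn_gt0.
have [P [c [P0 cA0 cP hc]]] := chain_tower es0 AD cA Aa Ab.
have PR n : 0 < (P n)%:R :> R by rewrite ltr0n.
pose pos (t : R) n := Num.max t 0 * (P n)%:R.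
have pos0 t n : 0 <= pos t n by rewrite mulr_ge0// le_max lexx orbT.
pose g n (t : R) := c n (Num.truncn (pos t n)).
have [||G hG] := @geometric_limit _ g r.
- by move=> n t; have [_ _ h _] := cP n; exact: h.
- move=> n t; apply: ltW; rewrite /g.
  have [N [N0 PE hN]] := hc n.
  set i := Num.truncn (pos t n); set m := Num.truncn _.
  have /andP[i1 i2] := truncn_itv (pos0 t n).
  have /andP[m1 m2] := truncn_itv (pos0 t n.+1).
  have posE : pos t n.+1 = pos t n * N%:R by rewrite /pos PE natrM mulrA.
  have im : (i * N <= m)%N.
    by rewrite /m truncn_ge_nat// natrM posE ler_wpM2r.
  (* So [m] is in the block of [N] indices that refines link [i]. *)
  have mi : (m - i * N < N)%N.
    rewrite ltn_subLR// -mulSnr -(ltr_nat R) (le_lt_trans m1)// natrM posE.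
    by rewrite ltr_pM2r// ltr0n.
  by have := hN i _ mi; rewrite subnKC.
have gG (t : R) (x : T) : (forall n, g n t = x) -> G t = x.
  move=> gx; have [_ h] := hG t; apply/esym/mdist_positivity/eqP.
  rewrite eq_le mdist_ge0 andbT; apply/ler_addgt0Pr => e e0; rewrite add0r.
  have [n hn] := half_pow_lt r e0.
  by apply: le_trans (ltW hn); rewrite -(gx n).
exists G; split.
- apply/continuous_mdistP => t e e0.
  have e30 : 0 < e / 3 by rewrite divr_gt0.
  have [n hn] := half_pow_lt r e30.
  (* Times closer than this have indices at stage [n] that differ by at most one. *)
  exists (P n)%:R^-1; first by rewrite invr_gt0.
  move=> u tu.
  have tu1 : `|pos t n - pos u n| < 1.
    rewrite -mulrBl normrM (gtr0_norm (PR n)) -ltr_pdivlMr// div1r.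
    exact: le_lt_trans (dist_max0 t u) tu.
  have h1 := truncn_near (pos0 t n) (pos0 u n) tu1.
  have ut1 : `|pos u n - pos t n| < 1 by rewrite distrC.
  have h2 := truncn_near (pos0 u n) (pos0 t n) ut1.
  have [_ _ _ hs] := cP n.
  have es_le : es n <= r / 2 ^+ n.
    rewrite /es exprS invfM mulrCA ler_piMl//; last by rewrite invf_le1// ler1n.
    by rewrite divr_ge0// ?exprn_ge0// ltW.
  have gtu : mdist (g n t) (g n u) < e / 3.
    apply: lt_trans hn; apply: lt_le_trans es_le; rewrite /g.
    move: h1 h2; rewrite leq_eqVlt => /orP[/eqP -> _|].
      by rewrite metric_sym.
    rewrite ltnS => h1; rewrite leq_eqVlt => /orP[/eqP -> //|].
    rewrite ltnS => h2; have -> : Num.truncn (pos t n) = Num.truncn (pos u n).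
      by apply/eqP; rewrite eqn_leq h1 h2.
    by rewrite mdistxx.
  have [_ /(_ n) ht] := hG t; have [_ /(_ n) hu] := hG u.
  rewrite metric_sym in ht.
  have := metric_triangle (G t) (g n t) (G u).
  have := metric_triangle (g n t) (g n u) (G u).
  lra.
- move=> t t0; apply: gG => n; rewrite /g /pos max_r// mul0r truncn0.
  by have [] := cP n.
- move=> t t1; apply: gG => n; have [_ h _ _] := cP n; apply: h.
  rewrite truncn_ge_nat// /pos max_l ?(le_trans ler01)//.
  by rewrite ler_peMl.
- move=> t; have [Dt ht] := hG t; split => //; exists (g 0%N t); first exact: cA0.
  by have := ht 0%N; rewrite expr0 divr1.
Qed.

End Paths.

(** * Cutting the loops out of a path *)

Section Monotone.
Context {R : realType}.

Lemma last_outside (U : set R) (p x : R) : open U -> ~ U p -> p <= x ->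
  exists y, [/\ p <= y, y <= x, ~ U y & forall u, y < u -> u <= x -> U u].
Proof.
move=> oU nUp px; pose E := [set u | u <= x /\ ~ U u].
have Ep : E p by [].
have Ex : ubound E x by move=> u [].
have hE : has_sup E by split; [exists p|exists x].
exists (sup E); split.
- exact: ub_le_sup hE.2 _ Ep.
- exact: ge_sup (ex_intro _ p Ep) Ex.
- rewrite openE in oU; move=> /oU/nbhs_ballP[e e0 he].
  have [u Eu eu] := sup_adherent e0 hE.
  have uE : u <= sup E by exact: ub_le_sup hE.2 _ Eu.
  case: Eu => _; apply; apply: he; rewrite /ball /= ger0_norm; lra.
- move=> u Eu ux; apply: contrapT => nUu.
  by have := ub_le_sup hE.2 (conj ux nUu : E u); rewrite leNgt Eu.
Qed.

Lemma first_outside (U : set R) (p x : R) : open U -> ~ U p -> x <= p ->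
  exists y, [/\ x <= y, y <= p, ~ U y & forall u, x <= u -> u < y -> U u].
Proof.
move=> oU nUp px.
have oU' : open (-%R @^-1` U) by apply: open_comp => // u _; exact: opp_continuous.
have [||y [y1 y2 nUy hy]] := @last_outside (-%R @^-1` U) (- p) (- x) oU'.
- by rewrite /preimage /= opprK.
- by rewrite lerN2.
exists (- y); split => //; [lra|lra|].
by move=> u xu uy; have := hy (- u); rewrite /preimage /= opprK; apply; lra.
Qed.

Context {T : metricType R}.
Variables (g : R -> T) (a b : T).
Hypothesis cg : continuous g.
Hypothesis g0 : forall t, t <= 0 -> g t = a.
Hypothesis g1 : forall t, 1 <= t -> g t = b.

(* [U] is a union of disjoint open intervals, each of which can be cut out of
   the path [g] since [g] agrees at its two endpoints. *)
Let cuttable (U : set R) := [/\ open U, forall u, U u -> 0 < u < 1 &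
  forall s t, s < t -> ~ U s -> ~ U t -> (forall u, s < u -> u < t -> U u) ->
    g s = g t].

(** The chain condition for Zorn's lemma. Inside an interval []s, t[] of the union, compactness puts
    a slightly smaller segment in a single member [X]. The interval of [X] around it has ends [s']
    and [t'] close to [s] and [t], where [g] agrees. *)
Lemma cuttable_bigcup (F : set (set R)) : F `<=` cuttable ->
  total_on F subset -> cuttable (\bigcup_(X in F) X).
Proof.
move=> FC tF; split.
- by apply: bigcup_open => X /FC[].
- by move=> u [X /FC[_ h _]] /h.
move=> s t st nUs nUt hst.
have [X0 FX0 _] : (\bigcup_(X in F) X) ((s + t) / 2) by apply: hst; lra.
apply/mdist_positivity/eqP; rewrite eq_le mdist_ge0 andbT.
apply/ler_addgt0Pr => e e0; rewrite add0r.
have e20 : 0 < e / 2 by rewrite divr_gt0.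
have [d1 d10 hd1] := (continuous_mdistP g).1 cg s _ e20.
have [d2 d20 hd2] := (continuous_mdistP g).1 cg t _ e20.
(* Thirds of [m] leave a nonempty middle segment and keep [s'] and [t'] within the moduli [d1] and
   [d2]. *)
pose m := Num.min (Num.min d1 d2) (t - s).
have m0 : 0 < m by rewrite !lt_min d10 d20 subr_gt0.
have [m1 m2 m3] : [/\ m <= d1, m <= d2 & m <= t - s].
  by split; rewrite !ge_min lexx ?orbT.
have [|||||X FX hX] := @compact_open_chain R^o `[s + m / 3, t - m / 3]%classic F.
- exact: segment_compact.
- by exists X0.
- by move=> X /FC[].
- exact: tF.
- by move=> u; rewrite /= in_itv /= => /andP[u1 u2]; apply: hst; lra.
have [oX _ gX] := FC _ FX.
have nX u : ~ (\bigcup_(X in F) X) u -> ~ X u by move=> h Xu; apply: h; exists X.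
have [|s' [s1 s2 nXs' hs']] := @last_outside X s (s + m / 3) oX (nX _ nUs).
  by lra.
have [|t' [t1 t2 nXt' ht']] := @first_outside X t (t - m / 3) oX (nX _ nUt).
  by lra.
have gst : g s' = g t'.
  apply: gX => //; first by lra.
  move=> u su ut; have [u1|u1] := leP u (s + m / 3); first exact: hs'.
  have [u2|u2] := leP (t - m / 3) u; first exact: ht'.
  by apply: hX; rewrite /= in_itv /=; apply/andP; split; lra.
have h1 : mdist (g s) (g s') < e / 2.
  by apply: hd1; rewrite ler0_norm; lra.
have h2 : mdist (g t) (g t') < e / 2.
  by apply: hd2; rewrite ger0_norm; lra.
have := metric_triangle (g s) (g s') (g t).
rewrite {2}gst (metric_sym (g t')); lra.
Qed.

(** With [U] maximal, [psi t] is the value of [g] at [l t], the last time up to [t] outside [U]. A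
    fiber of [psi] that is not convex would give one more loop to cut out. *)
Lemma monotone_path : exists psi : R -> T, [/\ continuous psi,
  forall t, t <= 0 -> psi t = a, forall t, 1 <= t -> psi t = b,
  forall s u t, s <= u -> u <= t -> psi s = psi t -> psi u = psi s &
  forall t, exists s, psi t = g s].
Proof.
have [U [[oU U01 gU] maxU]] := Zorn_bigcup cuttable_bigcup.
have absorb s t : ~ U s -> ~ U t -> g s = g t ->
    forall u, s < u -> u < t -> 0 < u -> u < 1 -> U u.
  move=> nUs nUt gst u0 su0 u0t u00 u01.
  (* Clipping to the unit interval leaves the values of [g] at the ends unchanged. If [u0] were
     outside [U], adding []s', t'[] would contradict maximality. *)
  pose s' := Num.max s 0; pose t' := Num.min t 1.
  have s's : (s <= 0 /\ s' = 0) \/ (0 <= s /\ s' = s).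
    by rewrite /s'; case: (leP s 0) => h; [left|right; split; first exact: ltW].
  have t't : (1 <= t /\ t' = 1) \/ (t <= 1 /\ t' = t).
    by rewrite /t'; case: (leP t 1) => h; [right|left; split; first exact: ltW].
  have nUs' : ~ U s'.
    by case: s's => -[_ ->] // /U01; rewrite ltxx.
  have nUt' : ~ U t'.
    by case: t't => -[_ ->] // /U01; rewrite ltxx andbF.
  have gst' : g s' = g t'.
    have -> : g s' = g s by case: s's => -[h ->] //; rewrite !g0.
    by have -> : g t' = g t by case: t't => -[h ->] //; rewrite !g1.
  have su : s' < u0 by rewrite /s' gt_max su0.
  have ut : u0 < t' by rewrite /t' lt_min u0t.
  apply: contrapT => nUu.
  apply: (maxU (U `|` `]s', t'[%classic)).
    rewrite properEneq; split; last by move=> x; left.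
    apply/eqP => E; apply: nUu; rewrite E; right.
    by rewrite /= in_itv /= su.
  split.
  - by apply: openU => //; exact: interval_open.
  - move=> u [/U01//|]; rewrite /= in_itv /= => /andP[h1 h2].
    by case: s's => -[? s'E]; case: t't => -[? t'E]; rewrite s'E t'E in h1 h2; lra.
  - move=> x y xy nx ny h.
    have [] : ~ U x /\ ~ U y by split => z; [apply: nx|apply: ny]; left.
    move=> nUx nUy.
    have nx' : x <= s' \/ t' <= x.
      have [?|h1] := leP x s'; [by left|right]; rewrite leNgt; apply/negP => h2.
      by apply: nx; right; rewrite /= in_itv /= h1.
    have ny' : y <= s' \/ t' <= y.
      have [?|h1] := leP y s'; [by left|right]; rewrite leNgt; apply/negP => h2.
      by apply: ny; right; rewrite /= in_itv /= h1.
    have s't' := lt_trans su ut.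
    (* An interval of the enlarged set on one side of []s', t'[] is an interval of [U]; any other
       has exactly the ends [s'] and [t']. *)
    have gap : (y <= s' \/ t' <= x) -> g x = g y.
      move=> yx; apply: gU => // u xu uy.
      have [//|] := h u xu uy; rewrite /= in_itv /= => /andP[u1 u2].
      case: yx => yx; first by have := lt_trans u1 uy; rewrite ltNge yx.
      by have := lt_trans xu u2; rewrite ltNge yx.
    case: ny' => [ys|ty]; first by apply: gap; left.
    case: nx' => [xs|tx]; last by apply: gap; right.
    have xE : x = s'.
      apply/eqP; rewrite eq_le xs leNgt; apply/negP => xs'.
      have [|//|] := h s' xs'; first by lra.
      by rewrite /= in_itv /= ltxx.
    have yE : y = t'.
      apply/eqP; rewrite eq_le ty andbT leNgt; apply/negP => ty'.
      have [|//|] := h t' _ ty'; first by lra.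
      by rewrite /= in_itv /= ltxx andbF.
    by rewrite xE yE.
have nU0 t : t <= 0 -> ~ U t by move=> t0 /U01; lra.
have nU1 t : 1 <= t -> ~ U t by move=> t0 /U01; lra.
have /choice[l hl] : forall t, exists y, [/\ y <= t, ~ U y &
    forall u, y < u -> u <= t -> U u].
  (* [Num.min t 0] is a time up to [t] that is outside [U]. *)
  move=> t; have [||y [_ ? ? ?]] := @last_outside U (Num.min t 0) t oU;
    last by exists y.
  - by apply: nU0; rewrite ge_min lexx orbT.
  - by rewrite ge_min lexx.
have lid t : ~ U t -> l t = t.
  move=> nUt; have [lt _ h] := hl t; apply/eqP; rewrite eq_le lt leNgt.
  by apply/negP => /h h'; apply: nUt; exact: h'.
have lmono s t : s <= t -> l s <= l t.
  move=> st; have [ls nUl _] := hl s; have [_ _ h] := hl t.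
  rewrite leNgt; apply/negP => ts; apply: nUl; apply: h => //; lra.
(* The values of [g \o l] at [s] and [t] agree or are values of [g] at two times between [s] and
   [t], so [g \o l] inherits the continuity of [g]. *)
have key s t : s <= t -> g (l s) = g (l t) \/
    exists s' t', [/\ s <= s', s' <= t', t' <= t, g (l s) = g s' & g (l t) = g t'].
  move=> st; have [ls nUls hs] := hl s; have [lt nUlt ht] := hl t.
  have [lts|slt] := leP (l t) s.
    left; congr g; apply/eqP; rewrite eq_le lmono//= leNgt; apply/negP => h.
    by apply: nUlt; exact: hs.
  have [y [sy yl nUy hy]] := first_outside oU nUlt (ltW slt).
  right; exists y, (l t); split => //.
  have [->//|lsy] := eqVneq (l s) y.
  apply: gU => //; first by rewrite lt_neqAle lsy (le_trans ls).
  move=> u lu uy; have [us|su] := leP u s; first exact: hs.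
  by apply: hy => //; exact: ltW.
exists (g \o l); split => /=.
- apply/continuous_mdistP => t e e0.
  have e20 : 0 < e / 2 by rewrite divr_gt0.
  have [d d0 hd] := (continuous_mdistP g).1 cg t _ e20.
  have close x y : `|t - x| < d -> `|t - y| < d -> mdist (g x) (g y) < e.
    move=> /hd h1 /hd h2; rewrite metric_sym in h1.
    by have := metric_triangle (g x) (g t) (g y); lra.
  have between x y z : `|t - x| < d -> `|t - y| < d -> x <= z -> z <= y ->
      `|t - z| < d.
    by rewrite !ltr_norml => /andP[? ?] /andP[? ?] ? ?; apply/andP; split; lra.
  have tt : `|t - t| < d by rewrite subrr normr0.
  have main x y : x <= y -> `|t - x| < d -> `|t - y| < d ->
      mdist (g (l x)) (g (l y)) < e.
    move=> xy hx hy; have [->|] := key x y xy; first by rewrite mdistxx.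
    move=> [s' [t' [h1 h2 h3 -> ->]]]; apply: close.
      by apply: between hx hy h1 _; exact: le_trans h3.
    by apply: between hx hy _ h3; exact: le_trans h2.
  exists d => // u tu; have [ut|/ltW ut] := leP t u; first exact: main.
  by rewrite metric_sym; exact: main.
- by move=> t t0; rewrite lid ?g0//; exact: nU0.
- by move=> t t0; rewrite lid ?g1//; exact: nU1.
- move=> s u t su ut gst.
  have := lmono _ _ su; rewrite le_eqVlt => /orP[/eqP -> //|lsu].
  have := lmono _ _ ut; rewrite le_eqVlt => /orP[/eqP -> //|lut].
  have [_ nUs _] := hl s; have [_ nUu _] := hl u; have [_ nUt _] := hl t.
  (* Now [l u] is strictly between [l s] and [l t]. Up to [0] and from [1] on [g] is constant; in
     between, [absorb] would put [l u] in [U]. *)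
  have [u0|u0] := leP (l u) 0.
    by rewrite !g0//; lra.
  have [u1|u1] := leP 1 (l u).
    by rewrite gst !g1//; lra.
  by exfalso; apply: nUu; apply: (absorb _ _ nUs nUt gst).
- by move=> t; exists (l t).
Qed.

End Monotone.

(** * Quotients of compact spaces *)

Lemma compact_quotient_continuous (P X Y : topologicalType) (K : set P) (q : P -> X)
    (f : P -> Y) (F : X -> Y) : hausdorff_space X -> compact K ->
  {within K, continuous q} -> {within K, continuous f} ->
  (forall t, K t -> F (q t) = f t) -> {within q @` K, continuous F}.
Proof.
move=> hX kK cq cf Ff; apply/subspace_continuousP => _ [t Kt <-] V FV.
have nV : nbhs (f t) V by rewrite -Ff.
(* The points of [K] sent by [f] outside the interior of [V] form a compact set. Its image by [q] is
   closed and misses [q t], so the complement of this image is the required neighbourhood. *)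
have /closed_subspaceP[C cC CE] : closed (f @^-1` (~` V°) : set (subspace K)).
  by apply: (continuous_closedP _).1 => //; apply: open_closedC; exact: open_interior.
pose K' := K `&` C.
have K'K : K' `<=` K by move=> x [].
have kK' : compact K' by exact: compact_closedI.
have nbq : nbhs (q t) (~` (q @` K')).
  apply: open_nbhs_nbhs; split.
    apply: closed_openC; apply: compact_closed => //.
    by apply: continuous_compact => //; exact: continuous_subspaceW cq.
  move=> [s [Ks Cs] qs].
  have : (f @^-1` (~` V°) `&` K) s by rewrite -CE.
  by move=> [/= + _]; apply; rewrite -Ff// qs Ff.
apply: filterS nbq => z nK [s Ks sz].
move: nK; rewrite -sz /= /from_subspace Ff// => nK.
apply: contrapT => nVs; apply: nK; exists s => //; split => //.
have : (f @^-1` (~` V°) `&` K) s by split => //= /interior_subset.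
by rewrite -CE => -[].
Qed.

(** * Running suprema and their weighted sums *)

Section RunningSup.
Context {R : realType}.
Variable phi : R -> R.
Hypothesis cphi : forall t e, 0 < e -> exists2 s, 0 < s & forall u, `|t - u| < s ->
    `|phi t - phi u| < e.
Hypothesis phi01 : forall t, 0 <= phi t <= 1.

Definition running_sup t := sup (phi @` [set s | s <= t]).

Let hassup t : has_sup (phi @` [set s | s <= t]).
Proof.
split; first by exists (phi t), t => //=.
by exists 1 => _ [s _ <-]; have /andP[] := phi01 s.
Qed.

Lemma running_sup_ge s t : s <= t -> phi s <= running_sup t.
Proof. by move=> st; apply: (ub_le_sup (hassup t).2); exists s. Qed.

Lemma running_sup_le t c : (forall s, s <= t -> phi s <= c) -> running_sup t <= c.
Proof. by move=> h; apply: (ge_sup (hassup t).1) => _ [s st <-]; exact: h. Qed.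

Lemma running_sup01 t : 0 <= running_sup t <= 1.
Proof.
apply/andP; split.
  have /andP[h _] := phi01 t; exact: le_trans h (running_sup_ge (lexx t)).
by apply: running_sup_le => s _; have /andP[] := phi01 s.
Qed.

Lemma running_sup_mono s t : s <= t -> running_sup s <= running_sup t.
Proof.
by move=> st; apply: running_sup_le => u us; apply/running_sup_ge/(le_trans us).
Qed.

Lemma running_sup_step s t c : s <= t -> 0 <= c ->
  (forall u, s <= u -> u <= t -> phi u <= phi s + c) ->
  running_sup t <= running_sup s + c.
Proof.
move=> st c0 h; apply: running_sup_le => u ut.
have [us|/ltW su] := leP u s.
  by apply: le_trans (running_sup_ge us) _; rewrite lerDl.
by apply: le_trans (h u su ut) _; rewrite lerD2r running_sup_ge.
Qed.

Lemma running_sup_continuous : continuous running_sup.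
Proof.
move=> t; apply/cvgrPdist_lt => e e0.
have e30 : 0 < e / 3 by rewrite divr_gt0.
have [d d0 hd] := cphi t e30.
apply/nbhs_ballP; exists d => // u; rewrite /ball /= => tu.
have key x y : x <= y -> `|t - x| < d -> `|t - y| < d ->
    running_sup y <= running_sup x + (e / 3 + e / 3).
  move=> xy tx ty; apply: running_sup_step => //; first by rewrite addr_ge0// ltW.
  move=> z xz zy.
  have tz : `|t - z| < d.
    move: tx ty; rewrite !ltr_norml => /andP[? ?] /andP[? ?].
    by apply/andP; split; lra.
  have := hd _ tz; have := hd _ tx; rewrite !ltr_norml => /andP[? ?] /andP[? ?].
  lra.
have tt : `|t - t| < d by rewrite subrr normr0.
have [h|/ltW h] := leP t u.
  have := running_sup_mono h; have := key _ _ h tt tu.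
  by move=> ? ?; rewrite ler0_norm; lra.
have := running_sup_mono h; have := key _ _ h tu tt.
by move=> ? ?; rewrite ger0_norm; lra.
Qed.

End RunningSup.

(** The function [h] is the sum of the [M n / 2 ^+ n.+1]. Convergence is uniform, and as the terms
    are nondecreasing with positive weights, [h] takes equal values only where every term does. *)
Lemma weighted_limit (R : realType) (M : nat -> R -> R) :
  (forall n, continuous (M n)) -> (forall n t, 0 <= M n t <= 1) ->
  (forall n s t, s <= t -> M n s <= M n t) ->
  exists h : R -> R, [/\ continuous h, forall s t, s <= t -> h s <= h t &
    forall s t, s <= t -> (h s = h t <-> forall n, M n s = M n t)].
Proof.
move=> cM M01 Mm.
pose S n t := \sum_(k < n) M k t / 2 ^+ k.+1.
have SS n t : S n.+1 t = S n t + M n t / 2 ^+ n.+1 by rewrite /S big_ord_recr.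
have p0 n : 0 < (2:R) ^+ n by rewrite exprn_gt0.
have term n t : 0 <= M n t / 2 ^+ n.+1 <= 1 / 2 ^+ n.+1.
  have /andP[h1 h2] := M01 n t.
  by rewrite divr_ge0 ?(ltW (p0 _))//= ler_pM2r// invr_gt0.
have S01 n t : 0 <= S n t <= 1 - 1 / 2 ^+ n.
  elim: n => [|n /andP[h1 h2]]; first by rewrite /S big_ord0 expr0 divr1 subrr lexx.
  rewrite SS; have /andP[h3 h4] := term n t.
  have : 1 / 2 ^+ n = 1 / 2 ^+ n.+1 + 1 / 2 ^+ n.+1 :> R.
    rewrite exprS invfM mulrA -mulrDl; congr (_ * _); lra.
  by move=> E; apply/andP; split; lra.
have kI : compact (`[0, 1]%classic : set R^o) by exact: segment_compact.
have [||h hh] := @geometric_limit R R^o _ kI R S 1.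
- move=> n t; have /andP[h1 h2] := S01 n t; have := p0 n; rewrite -invr_gt0 => ?.
  by rewrite /= in_itv /=; apply/andP; split; lra.
- move=> n t; rewrite /mdist /= SS [X in `|X|]addrAC subrr add0r.
  by have /andP[h1 h2] := term n t; rewrite ger0_norm.
have {}hh t n : `|h t - S n t| <= 1 / 2 ^+ n by have [_] := hh t; exact.
have sub e : 0 < e -> exists n, 1 / 2 ^+ n < e := @half_pow_lt R 1 e.
(* The omitted terms are nondecreasing too, so a partial sum grows no more than [h]. *)
have incr s t n : s <= t -> S n t - S n s <= h t - h s.
  move=> st; apply/ler_addgt0Pr => e e0.
  have e20 : 0 < e / 2 by rewrite divr_gt0.
  have [m hm] := sub _ e20.
  have Sm k : S n t - S n s <= S (n + k)%N t - S (n + k)%N s.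
    elim: k => [|k IH]; first by rewrite addn0.
    rewrite addnS !SS; apply: le_trans IH _.
    have : M (n + k)%N s / 2 ^+ (n + k).+1 <= M (n + k)%N t / 2 ^+ (n + k).+1.
      by rewrite ler_pM2r ?invr_gt0// Mm.
    by lra.
  have := Sm m; have := hh t (n + m)%N; have := hh s (n + m)%N.
  have : 1 / 2 ^+ (n + m) <= 1 / 2 ^+ m :> R.
    by rewrite !div1r lef_pV2 ?posrE// ler_weXn2l ?leq_addl// ler1n.
  rewrite !ler_norml => ? /andP[? ?] /andP[? ?] ?; lra.
have hm s t : s <= t -> h s <= h t.
  by move=> st; have := incr s t 0%N st; rewrite /S !big_ord0; lra.
have cS n : continuous (S n).
  move=> t; elim: n => [|n IH].
    have -> : S 0%N = fun=> 0 by apply/funext => u; rewrite /S big_ord0.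
    exact: cvg_cst.
  have -> : S n.+1 = S n \+ (fun u => M n u / 2 ^+ n.+1).
    by apply/funext => u; rewrite SS.
  by apply: cvgD => //; apply: cvgMl; exact: cM.
exists h; split => //.
- move=> t; apply/cvgrPdist_lt => e e0.
  have e30 : 0 < e / 3 by rewrite divr_gt0.
  have [n hn] := sub _ e30.
  have /cvgrPdist_lt/(_ _ e30) := cS n t; apply: filterS => u.
  have := hh t n; have := hh u n.
  rewrite !ler_norml !ltr_norml => /andP[? ?] /andP[? ?] /andP[? ?].
  by apply/andP; split; lra.
- move=> s t st; split=> [hst n|MM].
    have := incr s t n.+1 st; have := incr s t n st; rewrite !SS hst subrr.
    have S0 : S n s <= S n t.
      by apply: ler_sum => k _; rewrite ler_pM2r ?invr_gt0// Mm.
    have : M n s / 2 ^+ n.+1 <= M n t / 2 ^+ n.+1.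
      by rewrite ler_pM2r ?invr_gt0// Mm.
    move=> h1 h2 h3.
    have : M n s / 2 ^+ n.+1 = M n t / 2 ^+ n.+1 by lra.
    by move=> /mulIf; apply; rewrite invr_neq0// gt_eqF.
  apply/eqP; rewrite eq_le hm//=.
  apply/ler_addgt0Pr => e e0.
  have e20 : 0 < e / 2 by rewrite divr_gt0.
  have [n hn] := sub _ e20.
  have E : S n s = S n t by apply: eq_bigr => k _; rewrite MM.
  have := hh t n; have := hh s n; rewrite E.
  by rewrite !ler_norml => /andP[? ?] /andP[? ?]; lra.
Qed.

Lemma clamp01 (R : realType) : exists k : R -> R, [/\ forall t, k t \in `[0, 1],
  forall t, t \in `[0, 1] -> k t = t & forall t u, `|k t - k u| <= `|t - u|].
Proof.
exists (fun t => Num.max (Num.min t 1) 0); split.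
- move=> t; rewrite in_itv /= le_max lexx orbT /= ge_max ler01 andbT.
  by rewrite ge_min lexx orbT.
- by move=> t; rewrite in_itv /= => /andP[t0 t1]; rewrite min_l// max_l.
- move=> t u; apply: le_trans (dist_max0 _ _) _.
  have h1 := ler_norm (t - u); have h2 := ler_norm (u - t).
  rewrite (distrC u t) in h2; rewrite ler_norml; apply/andP.
  by case: (leP t 1) => ?; case: (leP u 1) => ?; split; lra.
Qed.

(** * From a path with convex fibers to an arc *)

Section Arc.
Context {R : realType} {T : metricType R}.
Variable psi : R -> T.
Hypothesis cpsi : continuous psi.
Hypothesis mpsi : forall s u t, s <= u -> u <= t -> psi s = psi t -> psi u = psi s.

Lemma monotone_height : exists h : R -> R, [/\ continuous h,
  forall s t, s <= t -> h s <= h t &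
  forall s t, s <= t -> (h s = h t <-> psi s = psi t)].
Proof.
(* An enumeration of the rationals, with [0] at the indices that encode none. *)
pose q n : R := ratr (odflt 0 (unpickle n)).
(* [phi n] vanishes up to the [n]-th rational time [q n]: its running supremum
   grows between [s] and [t] for a suitable [q n] unless [psi] is constant there. *)
pose phi n s : R := Num.min 1 (mdist (psi (q n)) (psi (Num.max s (q n)))).
have phi01 n s : 0 <= phi n s <= 1.
  by rewrite /phi le_min ler01 mdist_ge0/= ge_min lexx.
have cphi n (t e : R) : 0 < e -> exists2 s, 0 < s & forall u, `|t - u| < s ->
    `|phi n t - phi n u| < e.
  move=> e0; have [s s0 hs] := (continuous_mdistP psi).1 cpsi (Num.max t (q n)) _ e0.
  exists s => // u tu.
  have /hs h : `|Num.max t (q n) - Num.max u (q n)| < s.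
    apply: le_lt_trans tu; have h1 := ler_norm (t - u); have h2 := ler_norm (u - t).
    rewrite (distrC u t) in h2; rewrite ler_norml; apply/andP.
    by case: (leP t (q n)) => ?; case: (leP u (q n)) => ?; split; lra.
  have := metric_triangle (psi (q n)) (psi (Num.max t (q n))) (psi (Num.max u (q n))).
  have := metric_triangle (psi (q n)) (psi (Num.max u (q n))) (psi (Num.max t (q n))).
  rewrite (metric_sym (psi (Num.max u (q n))) (psi (Num.max t (q n)))).
  rewrite /phi => h1 h2; rewrite ltr_norml; apply/andP.
  by case: (leP 1 (mdist (psi (q n)) (psi (Num.max t (q n))))) => ?;
     case: (leP 1 (mdist (psi (q n)) (psi (Num.max u (q n))))) => ?; split; lra.
have phi0 n s : s <= q n -> phi n s = 0.
  by move=> sq; rewrite /phi max_r// mdistxx min_r.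
have [|||h [ch hm hE]] := @weighted_limit R (fun n => running_sup (phi n)).
- by move=> n; exact: (running_sup_continuous (cphi n) (phi01 n)).
- by move=> n t; exact: (running_sup01 (phi01 n)).
- by move=> n s t; exact: (running_sup_mono (phi01 n)).
exists h; split => // s t st; rewrite (hE _ _ st); split=> [MM|pst n].
  apply: contrapT => nst.
  have d0 : 0 < mdist (psi s) (psi t) by rewrite mdist_gt0; exact/eqP.
  have {}st : s < t.
    by rewrite lt_neqAle st andbT; apply/eqP => E; apply: nst; rewrite E.
  (* At times before [s + d] the path is closer to [psi s] than [psi t] is. A rational [r] there has
     [psi r] different from [psi t], so its running supremum is [0] at [s] and positive at [t]. *)
  have [d dd hd] := (continuous_mdistP psi).1 cpsi s _ d0.
  have : s < Num.min t (s + d) by rewrite lt_min st ltrDl.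
  move=> /rat_in_itvoo[r]; rewrite in_itv /= lt_min => /and3P[sr rt rd].
  have qr : q (pickle r) = ratr r by rewrite /q pickleK.
  have : psi (ratr r) <> psi t.
    move=> E; have := hd (ratr r); rewrite E ltxx => h'.
    by have : false by apply: h'; rewrite ler0_norm; lra.
  move=> nrt; have := MM (pickle r).
  have M0 : running_sup (phi (pickle r)) s <= 0.
    by apply: running_sup_le => // u us; rewrite phi0// qr; lra.
  have : 0 < phi (pickle r) t.
    by rewrite /phi qr lt_min ltr01 max_l ?(ltW rt)// mdist_gt0; exact/eqP.
  have := running_sup_ge (phi01 (pickle r)) (lexx t).
  lra.
(* Convexity of the fibers makes [psi] constant from [s] to [t], so [phi n] is constant too and its
   running supremum does not grow. *)
have phist u : s <= u -> u <= t -> phi n u = phi n s.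
  move=> su ut; have us := mpsi su ut pst.
  have [sq|qs] := leP s (q n); last first.
    by rewrite /phi !max_l ?us// ?(ltW qs)// (le_trans (ltW qs)).
  rewrite (phi0 _ s)//; have [uq|/ltW qu] := leP u (q n); first exact: phi0.
  rewrite /phi max_l// us (mpsi sq _ pst) ?mdistxx ?min_r//.
  exact: le_trans ut.
apply/eqP; rewrite eq_le running_sup_mono//=.
rewrite -[leRHS]addr0; apply: (running_sup_step (phi01 n)) => // u su ut.
by rewrite addr0 phist.
Qed.

(** [psi] factors through its height, rescaled to [k] running from [0] to [1]. The factor is
    injective because [k] and [psi] have the same fibers, and continuous because [k] is a quotient
    map of the compact interval. *)
Lemma monotone_arc : psi 0 <> psi 1 -> exists al : R -> T,
  [/\ continuous al, {in `[0, 1] &, injective al},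
      al 0 = psi 0, al 1 = psi 1 & forall x, x \in `[0, 1] -> exists t, al x = psi t].
Proof.
move=> p01; have [h [ch hm hE]] := monotone_height.
have h01 : h 0 < h 1.
  rewrite lt_neqAle hm// andbT; apply/eqP => /hE; rewrite ler01 => /(_ isT).
  exact: p01.
have d0 : 0 < h 1 - h 0 by rewrite subr_gt0.
pose k t := (h t - h 0) / (h 1 - h 0).
have ck : continuous k.
  by move=> t; apply: cvgMl; apply: cvgB; [exact: ch|exact: cvg_cst].
have k0 : k 0 = 0 by rewrite /k subrr mul0r.
have k1 : k 1 = 1 by rewrite /k divff// gt_eqF.
have kE s t : k s = k t <-> psi s = psi t.
  have kh : k s = k t <-> h s = h t.
    split=> [/mulIf|]; last by rewrite /k => ->.
    by rewrite invr_neq0 ?gt_eqF// => /(_ isT)/addIr.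
  rewrite kh; have [st|/ltW st] := leP s t; first exact: hE.
  by have [h1 h2] := hE _ _ st; split=> /esym ?; apply/esym; [apply: h1|apply: h2].
(* Any preimage by [k] will do, as [psi] is constant on the fibers of [k]; outside the unit interval
   the value is a dummy. *)
have /choice[al hal] : forall x, exists t, x \in `[0, 1] ->
    t \in `[0, 1] /\ k t = x.
  move=> x; have [x01|nx] := boolP (x \in `[0, 1]); last by exists 0.
  have [||c c01 kc] := @IVT R k 0 1 x ler01; last by exists c.
    exact: continuous_subspaceT.
  by rewrite k0 k1 min_l// max_r//; move: x01; rewrite in_itv.
have k01 t : t \in `[0, 1] -> k t \in `[0, 1].
  rewrite !in_itv /= => /andP[t0 t1].
  by rewrite divr_ge0 ?subr_ge0 ?hm ?ler01//= ler_pdivrMr// mul1r lerD2r hm.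
have kim : k @` `[0, 1]%classic = `[0, 1]%classic.
  apply/seteqP; split=> [_ [t t01 <-]|x x01]; first exact: k01.
  by have [? ?] := hal x x01; exists (al x).
have in0 : 0 \in `[0, 1 : R] by rewrite in_itv /= lexx ler01.
have in1 : 1 \in `[0, 1 : R] by rewrite in_itv /= lexx ler01.
have cal : {within `[0, 1], continuous (psi \o al)}.
  have := @compact_quotient_continuous R R T `[0, 1]%classic k psi (psi \o al).
  rewrite kim; apply.
  - exact: Rhausdorff.
  - exact: segment_compact.
  - exact: continuous_subspaceT.
  - exact: continuous_subspaceT.
  - by move=> t t01 /=; apply/kE; have [] := hal _ (k01 _ t01).
(* Clamping extends the factor continuously to the whole line. *)
have [c [c01 cid cl]] := @clamp01 R.
exists (psi \o al \o c); split => /=.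
- apply/continuous_mdistP => t e e0.
  have [r r0 hr] := (@nbhs_within_mdistP R R^o T _ _).1 cal (c t) (c01 t) _
    (nbhsx_ballx _ _ e0).
  exists r => // u tu; have := hr (c u) (c01 u); rewrite ballEmdist; apply.
  by rewrite /mdist /= distrC; apply: le_lt_trans tu.
- move=> x y x01 y01 /= /kE; rewrite !cid//; have [_ ->] := hal x x01.
  by have [_ ->] := hal y y01.
- by apply/kE; rewrite cid//; have [_ ->] := hal 0 in0.
- by apply/kE; rewrite cid//; have [_ ->] := hal 1 in1.
- by move=> x _; exists (al (c x)).
Qed.

End Arc.

Lemma arc_near (R : realType) (T : metricType R) (D A : set T) (a b : T) (r : R) :
  locally_connected D -> compact D -> A `<=` D -> connected A -> A a -> A b ->
  a <> b -> 0 < r -> exists al : R -> T, [/\ continuous al,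
    {in `[0, 1] &, injective al}, al 0 = a, al 1 = b &
    forall x, x \in `[0, 1] -> D (al x) /\ exists2 y, A y & mdist y (al x) <= r].
Proof.
move=> lD kD AD cA Aa Ab ab r0.
have [g [cg g0 g1 hg]] := path_near lD kD AD cA Aa Ab r0.
have [psi [cpsi psi0 psi1 mpsi hpsi]] := monotone_path cg g0 g1.
have p01 : psi 0 <> psi 1 by rewrite psi0// psi1.
have [al [cal ial al0 al1 hal]] := monotone_arc cpsi mpsi p01.
exists al; split => //; [by rewrite al0 psi0|by rewrite al1 psi1|].
by move=> x /hal[t ->]; have [s ->] := hpsi t.
Qed.

(** * Simple closed curves *)

Lemma continuous_circle_coord (R : realType) :
  continuous (fun z : R * R => z.1 ^+ 2 + z.2 ^+ 2).
Proof.
move=> z; apply: cvgD.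
  apply: (@cvg_comp _ _ _ fst (fun x : R => x ^+ 2)); first exact: cvg_fst.
  exact: exprn_continuous.
apply: (@cvg_comp _ _ _ snd (fun x : R => x ^+ 2)); first exact: cvg_snd.
exact: exprn_continuous.
Qed.

Lemma unit_circle_bound (R : realType) (z : R * R) : unit_circle z ->
  -1 <= z.1 <= 1 /\ -1 <= z.2 <= 1.
Proof.
rewrite /unit_circle /= => zE.
have h1 := sqr_ge0 z.1; have h2 := sqr_ge0 z.2.
by split; rewrite -ler_norml -(@expr_le1 _ 2)// real_normK ?num_real//; lra.
Qed.

Lemma compact_unit_circle (R : realType) : compact (@unit_circle R).
Proof.
apply: (subclosed_compact _ (compact_setX
  (@segment_compact R (-1) 1) (@segment_compact R (-1) 1))).
  have -> : @unit_circle R = (fun z : R * R => z.1 ^+ 2 + z.2 ^+ 2) @^-1` [set 1].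
    by [].
  apply: (continuous_closedP _).1; first exact: continuous_circle_coord.
  exact: closed_eq.
by move=> z /unit_circle_bound[]; rewrite /= !in_itv.
Qed.

(** A continuous injection of a compact space into a Hausdorff space is an embedding: its inverse is
    the identity factored through [F]. *)
Lemma injective_circle (R : realType) (T : metricType R) (F : R * R -> T) :
  {within @unit_circle R, continuous F} ->
  (forall z w, unit_circle z -> unit_circle w -> F z = F w -> z = w) ->
  simple_closed_curve (F @` @unit_circle R).
Proof.
move=> cF iF.
have /choice[g hg] : forall y, exists z, (F @` @unit_circle R) y ->
    unit_circle z /\ F z = y.
  move=> y; have [[z Cz zy]|n] := pselect ((F @` @unit_circle R) y).
    by exists z.
  by exists (0, 0) => /n.
have gF z : unit_circle z -> g (F z) = z.
  move=> Cz; have [|Cg E] := hg (F z); first by exists z.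
  exact: iF.
exists F, g; split => //.
- split; first by move=> z Cz; exists z.
  by move=> y Sy; have [] := hg y Sy.
- by move=> z; rewrite inE; exact: gF.
- by move=> y; rewrite inE => /hg[].
- apply: (@compact_quotient_continuous
    (R * R)%type T (R * R)%type (@unit_circle R) F id g) => //.
  + exact: metric_hausdorff.
  + exact: compact_unit_circle.
  + by apply: continuous_subspaceT => z; exact: cvg_id.
Qed.

(** Around [t0] there is a maximal interval []u, v[] of times when [al] is off [be]; its ends are on
    [be], at times [s1] and [s2]. The upper half circle follows [al] from [u] to [v], the lower half
    [be] from [s1] to [s2]. *)
Lemma arcs_simple_closed_curve (R : realType) (T : metricType R)
    (al be : R -> T) (t0 : R) : continuous al -> continuous be ->
  {in `[0, 1] &, injective al} -> {in `[0, 1] &, injective be} ->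
  al 0 = be 0 -> al 1 = be 1 -> t0 \in `[0, 1] ->
  (forall s, s \in `[0, 1] -> be s <> al t0) ->
  exists2 S, S `<=` al @` `[0, 1] `|` be @` `[0, 1] & simple_closed_curve S.
Proof.
move=> cal cbe ial ibe ab0 ab1 t01 hbe.
have in0 : 0 \in `[0, 1 : R] by rewrite in_itv /= lexx ler01.
have in1 : 1 \in `[0, 1 : R] by rewrite in_itv /= lexx ler01.
pose U := al @^-1` (~` (be @` `[0, 1]%classic)).
have oU : open U.
  apply: open_comp => //; apply: closed_openC.
  apply: compact_closed; first exact: metric_hausdorff.
  apply: continuous_compact; last exact: segment_compact.
  exact: continuous_subspaceT.
have nU t : ~ U t -> exists s, [/\ 0 <= s, s <= 1 & al t = be s].
  move=> /contrapT[s]; rewrite /= in_itv /= => /andP[s0 s1] E.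
  by exists s; split.
have Ut0 : U t0 by move=> [s s01 E]; exact: (hbe s).
have nU0 : ~ U 0 by apply; exists 0 => //.
have nU1 : ~ U 1 by apply; exists 1 => //.
move: t01; rewrite in_itv /= => /andP[t00 t01].
have [u [u0 ut nUu hu]] := last_outside oU nU0 t00.
have [v [tv v1 nUv hv]] := first_outside oU nU1 t01.
have {ut}ut : u < t0.
  by rewrite lt_neqAle ut andbT; apply/eqP => E; apply: nUu; rewrite E.
have {tv}tv : t0 < v.
  by rewrite lt_neqAle tv andbT; apply/eqP => E; apply: nUv; rewrite -E.
have Uuv t : u < t -> t < v -> U t.
  by move=> h1 h2; have [h|/ltW h] := leP t t0; [exact: hu|exact: hv].
have [s1 [s10 s11 us1]] := nU u nUu.
have [s2 [s20 s21 vs2]] := nU v nUv.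
(* The times differ because [al] is injective, but they may come in either order. *)
have s12 : s1 - s2 != 0.
  apply/eqP => /subr0_eq E; have : u = v.
    by apply: ial; rewrite ?in_itv /= ?us1 ?vs2 ?E//; apply/andP; split; lra.
  lra.
(* Affine in the first coordinate: [-1] goes to [u] and [s1], [1] goes to [v] and [s2]. *)
pose p x := u + (v - u) * ((1 + x) / 2).
pose q x := s1 + (s2 - s1) * ((1 + x) / 2).
have puv x : -1 <= x <= 1 -> u <= p x <= v.
  by move=> /andP[x0 x1]; rewrite /p; apply/andP; split; nra.
have p01 x : -1 <= x <= 1 -> p x \in `[0, 1].
  by move=> /puv/andP[? ?]; rewrite in_itv /=; apply/andP; split; lra.
have q01 x : -1 <= x <= 1 -> q x \in `[0, 1].
  by move=> /andP[x0 x1]; rewrite /q in_itv /=; apply/andP; split; nra.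
have ip x y : p x = p y -> x = y.
  move=> /addrI/mulfI; rewrite subr_eq0 gt_eqF; last lra.
  by move=> /(_ isT); lra.
have iq x y : q x = q y -> x = y.
  move=> /addrI/mulfI; rewrite -oppr_eq0 opprB s12 => /(_ isT); lra.
have pm : p (-1) = u by rewrite /p; lra.
have p1 : p 1 = v by rewrite /p; lra.
have qm : q (-1) = s1 by rewrite /q; lra.
have q1 : q 1 = s2 by rewrite /q; lra.
pose F (z : R * R) := if 0 <= z.2 then al (p z.1) else be (q z.1).
have Flow z : unit_circle z -> z.2 <= 0 -> F z = be (q z.1).
  rewrite /F /unit_circle /= => zE z2; case: ifP => // z2'.
  have {}z2 : z.2 = 0 by apply/eqP; rewrite eq_le z2.
  move: zE; rewrite z2 expr0n addr0 => /eqP; rewrite sqrf_eq1 => /orP[]/eqP ->.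
    by rewrite p1 q1.
  by rewrite pm qm.
(* At a common value [p z.1] is a time when [al] is on [be], hence [u] or [v]. So [w] has first
   coordinate [-1] or [1] and cannot be strictly below the axis. *)
have mixed z w : unit_circle z -> unit_circle w -> w.2 < 0 ->
    al (p z.1) = be (q w.1) -> False.
  move=> Cz Cw w2 E.
  have [z1 _] := unit_circle_bound Cz; have [w1 _] := unit_circle_bound Cw.
  have nUp : ~ U (p z.1) by apply; exists (q w.1) => //; exact: q01.
  have /andP[up pv] := puv _ z1.
  have w1E : w.1 = -1 \/ w.1 = 1.
    have [pu|pu] := eqVneq (p z.1) u.
      left; apply: iq; rewrite qm; apply: ibe; rewrite ?q01//.
        by rewrite in_itv /= s10.
      by rewrite -us1 -E pu.
    have [pv'|pv'] := eqVneq (p z.1) v.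
      right; apply: iq; rewrite q1; apply: ibe; rewrite ?q01//.
        by rewrite in_itv /= s20.
      by rewrite -vs2 -E pv'.
    exfalso; apply: nUp; apply: Uuv; first by rewrite lt_neqAle eq_sym pu.
    by rewrite lt_neqAle pv'.
  have := Cw; rewrite /unit_circle /=.
  by case: w1E => ->; nra.
have F01 z : unit_circle z -> (al @` `[0, 1] `|` be @` `[0, 1]) (F z).
  move=> /unit_circle_bound[z1 _]; rewrite /F; case: ifP => _; [left|right].
    by exists (p z.1) => //; exact: p01.
  by exists (q z.1) => //; exact: q01.
exists (F @` @unit_circle R); first by move=> _ [z Cz <-]; exact: F01.
have caff (c d : R) : continuous (fun z : R * R => c + d * ((1 + z.1) / 2)).
  move=> z; apply: cvgD; first exact: cvg_cst.
  apply: cvgMr; apply: cvgMl; apply: cvgD; first exact: cvg_cst.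
  exact: cvg_fst.
apply: injective_circle.
(* Pasting over the two closed half circles; [Flow] covers the two common points. *)
- have -> : @unit_circle R = (@unit_circle R `&` [set z | 0 <= z.2]) `|`
      (@unit_circle R `&` [set z | z.2 <= 0]).
    rewrite -setIUr; apply/esym/setIidPl => z _ /=.
    by have [?|/ltW ?] := leP 0 z.2; [left|right].
  have cC : closed (@unit_circle R).
    apply: compact_closed; last exact: compact_unit_circle.
    exact: norm_hausdorff.
  have c2 : continuous (snd : R * R -> R) by move=> z; exact: cvg_snd.
  apply: withinU_continuous.
  + apply: closedI => //; exact: ((continuous_closedP _).1 c2 _ (@closed_ge R 0)).
  + apply: closedI => //; exact: ((continuous_closedP _).1 c2 _ (@closed_le R 0)).
  + apply: (@subspace_eq_continuous _ _ _ (fun z => al (p z.1))).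
      by move=> z; rewrite inE => -[_ /= z2]; rewrite /F /from_subspace z2.
    apply: continuous_subspaceT => z.
    exact: (continuous_comp (@caff u (v - u) z) (cal _)).
  + apply: (@subspace_eq_continuous _ _ _ (fun z => be (q z.1))).
      by move=> z; rewrite inE => -[Cz /= z2]; rewrite /from_subspace Flow.
    apply: continuous_subspaceT => z.
    exact: (continuous_comp (@caff s1 (s2 - s1) z) (cbe _)).
- move=> z w Cz Cw.
  have [z1 _] := unit_circle_bound Cz; have [w1 _] := unit_circle_bound Cw.
  have snd_eq : z.1 = w.1 -> (0 <= z.2 /\ 0 <= w.2) \/ (z.2 < 0 /\ w.2 < 0) -> z = w.
    move=> E1 h; have : z.2 ^+ 2 = w.2 ^+ 2.
      by move: Cz Cw; rewrite /unit_circle /= E1 => <- /addrI.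
    move=> /eqP; rewrite eqf_sqr => /orP[]/eqP E2.
      by rewrite (surjective_pairing z) (surjective_pairing w) E1 E2.
    rewrite (surjective_pairing z) (surjective_pairing w) E1; congr pair.
    by case: h => -[]; lra.
  rewrite /F; case: leP => z2; case: leP => w2.
  + by move=> /ial-/(_ (p01 _ z1) (p01 _ w1))/ip E; apply: snd_eq => //; left.
  + by move=> /(mixed _ _ Cz Cw w2).
  + by move=> /esym/(mixed _ _ Cw Cz z2).
  + by move=> /ibe-/(_ (q01 _ z1) (q01 _ w1))/iq E; apply: snd_eq => //; right.
Qed.

(** * Separation of points in a dendrite *)

Lemma dendrite_separated (R : realType) (T : metricType R) (D : set T) (a b : T) :
  dendrite D -> D a -> D b -> a <> b ->
  exists x, [/\ x <> a, x <> b & between D a x b].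
Proof.
move=> [[_ kD cD] lD noS] Da Db ab; apply: contrapT => nex; apply: noS.
have [al [cal ial al0 al1 hal]] :=
  arc_near lD kD (@subset_refl _ D) cD Da Db ab ltr01.
pose x := al (1 / 2).
have in0 : 0 \in `[0, 1 : R] by rewrite in_itv /= lexx ler01.
have in1 : 1 \in `[0, 1 : R] by rewrite in_itv /= lexx ler01.
have inh : 1 / 2 \in `[0, 1 : R] by rewrite in_itv /=; apply/andP; split; lra.
have xa : x <> a by rewrite -al0 => /(ial _ _ inh in0); lra.
have xb : x <> b by rewrite -al1 => /(ial _ _ inh in1); lra.
have nx : ~ between D a x b by move=> h; apply: nex; exists x.
have [B [e [BD cB Ba Bb [e0 hB]]]] := nbetween_far lD nx.
(* All points of [B] are at distance at least [e] from [x], so an arc within [e / 2] of [B] misses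
   [x]. *)
have e20 : 0 < e / 2 by rewrite divr_gt0.
have [be [cbe ibe be0 be1 hbe]] := arc_near lD kD BD cB Ba Bb ab e20.
have [|||S SD hS] := arcs_simple_closed_curve cal cbe ial ibe _ _ inh.
- by rewrite al0 be0.
- by rewrite al1 be1.
- move=> s s01 E; have [_ [y By]] := hbe s s01; rewrite E metric_sym => yx.
  by apply: (hB y) => //; rewrite -/x in yx; lra.
by exists S => // z /SD[] [t t01 <-];
  [have [] := hal t t01|have [] := hbe t t01].
Qed.

Theorem proposition3p5 (R : realType) (T : metricType R) (D1 D2 : set T)
    (f : T -> T)
    (hD1 : dendrite D1) (hD2 : dendrite D2) (hD12 : D1 `<=` D2)
    (hf : {within D1, continuous f}) (hfD : set_fun D1 D2 f)
    (hscr : scrambles_boundary D1 D2 f) :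
  exists2 x : T, D1 x & f x = x.
Proof.
have [D1c _ _] := hD1; have [D2c lD2 _] := hD2.
apply: (fixed_point_of_separators D1c D2c lD2) => // a b.
exact: dendrite_separated.
Qed.
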